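(* Let $m\ge 2$, $n\ge 1$, let $u_1,\dots,u_n\in\mathbb{R}^m$ be strictly positive vectors, and let $P\in\mathbb{R}^{m\times m}$ be a stochastic reversible matrix. For every $i$ define the $u_i$-Tilted matrix $P_i = D^{-1}(Pu_i)\,P\,D(u_i)$, and define the product $P^{\mathrm{prod}}_n=\prod_{i=1}^n P_i = P_1P_2\cdots P_n$. Then $$|\lambda_2(P^{\mathrm{prod}}_n)| \leq |\lambda_2(P)|^n \prod_{i=1}^n \left( \frac{\max_j u_i[j]}{\min_j u_i[j]}\right)^4 .$$
   Context: For a vector $x$, $D(x)$ is the diagonal matrix with $x$ on its diagonal, $D^{-1}(x)=(D(x))^{-1}$, and $x[j]$ is the $j$-th entry of $x$. A square matrix is stochastic if its entries are non-negative and each row sums to $1$. A stochastic matrix $P$ with stationary distribution $\mu_P$ (a probability vector with $\mu_P^\top P=\mu_P^\top$, all of whose entries are strictly positive so that $D(\mu_P)$ is invertible) is called reversible if $P=D^{-1}(\mu_P)P^\top D(\mu_P)$. For a square matrix $A$, $\lambda_1(A),\lambda_2(A),\dots$ are its (complex) eigenvalues listed with algebraic multiplicity in order of non-increasing absolute value, so $\lambda_2(A)$ is the second largest in modulus. *)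

(* Defs.v *)
From HB Require Import structures.
From mathcomp Require Import all_boot all_order all_algebra.
From mathcomp Require Import reals.
From mathcomp Require Import complex.

Set Implicit Arguments.
Unset Strict Implicit.
Unset Printing Implicit Defensive.

Import Order.TTheory GRing.Theory Num.Theory.
Local Open Scope ring_scope.
Local Open Scope complex_scope.

Definition entries (R : realType) (m : nat) (x : 'cV[R]_m) : seq R :=
  [seq x j 0 | j : 'I_m].

(* The default value of these big operators is itself an entry as soon as
   m > 0, so they are the true extrema, whatever the signs of the entries
   (vmax_entries, vmin_entries, vmax_ub, vmin_lb). *)
Definition vmax (R : realType) (m : nat) (x : 'cV[R]_m) : R :=
  \big[Num.max/head 0 (entries x)]_(j < m) x j 0.

Definition vmin (R : realType) (m : nat) (x : 'cV[R]_m) : R :=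
  \big[Num.min/head 0 (entries x)]_(j < m) x j 0.

Definition positive (R : realType) (m : nat) (x : 'cV[R]_m) : Prop :=
  forall j, 0 < x j 0.

Definition D (R : realType) (m : nat) (x : 'cV[R]_m) : 'M[R]_m :=
  diag_mx x^T.

Definition Dinv (R : realType) (m : nat) (x : 'cV[R]_m) : 'M[R]_m :=
  invmx (D x).

Definition stochastic (R : realType) (m : nat) (P : 'M[R]_m) : Prop :=
  (forall i j, 0 <= P i j) /\ (forall i, \sum_j P i j = 1).

Definition stationary (R : realType) (m : nat) (P : 'M[R]_m)
    (mu : 'cV[R]_m) : Prop :=
  [/\ forall j, 0 <= mu j 0, \sum_j mu j 0 = 1 & mu^T *m P = mu^T].

(* P need not be irreducible, so mu need not be unique: reversibility is with
   respect to some strictly positive stationary distribution. *)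
Definition reversible (R : realType) (m : nat) (P : 'M[R]_m) : Prop :=
  exists mu : 'cV[R]_m,
    [/\ stationary P mu, positive mu & P = Dinv mu *m P^T *m D mu].

Definition tilted (R : realType) (m : nat) (P : 'M[R]_m) (u : 'cV[R]_m) :
    'M[R]_m :=
  Dinv (P *m u) *m P *m D u.

Definition cmod (R : realType) (z : R[i]) : R := complex.Re `|z|.

Definition char_polyC (R : realType) (m : nat) (A : 'M[R]_m) : {poly R[i]} :=
  char_poly (map_mx (real_complex R) A).

(* The choice made among eigenvalues of equal modulus is unspecified; it does
   not affect the modulus of the k-th eigenvalue. *)
Definition eigenvalues (R : realType) (m : nat) (A : 'M[R]_m) : seq R[i] :=
  sort (fun z w => cmod w <= cmod z)
       (sval (closed_field_poly_normal (char_polyC A))).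

(* The index k starts at 1. *)
Definition lambda (R : realType) (m : nat) (k : nat) (A : 'M[R]_m) : R[i] :=
  nth 0 (eigenvalues A) k.-1.

Lemma char_polyC_eigenvalues (R : realType) (m : nat) (A : 'M[R]_m) :
  char_polyC A = \prod_(z <- eigenvalues A) ('X - z%:P).
Proof.
rewrite /eigenvalues; case: closed_field_poly_normal => r /= rE.
rewrite {1}rE (monicP (char_poly_monic _)) scale1r.
by apply: perm_big; rewrite perm_sym perm_sort.
Qed.

Lemma size_eigenvalues (R : realType) (m : nat) (A : 'M[R]_m) :
  size (eigenvalues A) = m.
Proof.
have := size_char_poly (map_mx (real_complex R) A).
by rewrite -/(char_polyC A) char_polyC_eigenvalues size_prod_XsubC => -[].
Qed.

Lemma eigenvalues_sorted (R : realType) (m : nat) (A : 'M[R]_m) :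
  sorted (fun z w => cmod w <= cmod z) (eigenvalues A).
Proof. by apply: sort_sorted => z w; exact: le_total. Qed.

Lemma vmax_ub (R : realType) (m : nat) (x : 'cV[R]_m) j : x j 0 <= vmax x.
Proof. exact: (le_bigmax _ (fun k => x k 0)). Qed.

Lemma vmin_lb (R : realType) (m : nat) (x : 'cV[R]_m) j : vmin x <= x j 0.
Proof. exact: (bigmin_le_cond _ (fun k => x k 0)). Qed.

Lemma head_entries (R : realType) (m : nat) (x : 'cV[R]_m) :
  (0 < m)%N -> exists j, head 0 (entries x) = x j 0.
Proof.
move=> m0; have : head 0 (entries x) \in entries x.
  have : size (entries x) = m by rewrite size_map -cardE card_ord.
  by case: (entries x) => [|a s _]; [move=> /= mE; rewrite -mE in m0
                                    | rewrite /= mem_head].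
by case/mapP => j _ ->; exists j.
Qed.

Lemma vmax_entries (R : realType) (m : nat) (x : 'cV[R]_m) :
  (0 < m)%N -> exists j, vmax x = x j 0.
Proof.
move=> /(head_entries x)[j0 hE]; rewrite /vmax hE.
elim/big_ind: _ => [|a b [j ->] [k ->]|j _]; [by exists j0| |by exists j].
by case: (leP (x j 0) (x k 0)) => _; [exists k|exists j].
Qed.

Lemma vmin_entries (R : realType) (m : nat) (x : 'cV[R]_m) :
  (0 < m)%N -> exists j, vmin x = x j 0.
Proof.
move=> /(head_entries x)[j0 hE]; rewrite /vmin hE.
elim/big_ind: _ => [|a b [j ->] [k ->]|j _]; [by exists j0| |by exists j].
by case: (leP (x j 0) (x k 0)) => _; [exists j|exists k].
Qed.

(* Main.v *)
(* A matrix A fixing the constants acts on vectors modulo constants, and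
   |lambda_2(A)| is the largest modulus of an eigenvalue of that action.  On this
   quotient use the norm Var_mu.  Since P is self-adjoint for mu, the spectral
   theorem gives Var_mu(P v) <= |lambda_2(P)|^2 Var_mu(v).  For the tilted matrix,
   P_i v - c = D^-1(P u_i) P D(u_i) (v - c) for every constant c; taking c to be
   the mean of v with respect to the weights mu u_i makes D(u_i) (v - c)
   orthogonal to the constants, and c minimises the mu u_i-weighted second moment,
   so P_i contracts the norm by |lambda_2(P)| max u_i / min u_i.  Composing the
   contractions gives the bound even with exponent 1 in place of 4. *)
Require Import Defs.
From mathcomp Require Import all_boot all_order all_algebra.
From mathcomp Require Import reals.
From mathcomp Require Import complex ring.
Import Order.TTheory GRing.Theory Num.Theory.
Local Open Scope ring_scope.
Local Open Scope sesquilinear_scope.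

Set Implicit Arguments.
Unset Strict Implicit.

(** * Rank-one updates of characteristic polynomials *)

(** The block matrix [N] is made triangular from both sides: [L] leaves the block [a + x y], while
    [U], of determinant [a], leaves the diagonal blocks [a + y x] and [a]. Keeping the factor [a]
    avoids dividing by it when it is ['X - 1]. *)
Lemma det_scalar_rank1 (F : idomainType) (m : nat) (a : F)
    (x : 'cV[F]_m) (y : 'rV[F]_m) :
  a * \det (a%:M + x *m y) = (a + (y *m x) 0 0) * a ^+ m.
Proof.
pose N : 'M_(1 + m) := block_mx 1%:M (- y) x a%:M.
have detN : \det N = \det (a%:M + x *m y).
  pose L : 'M_(1 + m) := block_mx 1%:M 0 (- x) 1%:M.
  have -> : \det N = \det (L *m N).
    by rewrite det_mulmx det_lblock !det1 !mul1r.
  rewrite mulmx_block !mul1mx !mul0mx !addr0 mulmx1 addNr det_ublock det1 mul1r.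
  by rewrite mulNmx mulmxN opprK addrC.
pose U : 'M_(1 + m) := block_mx a%:M 0 (- x) 1%:M.
have := congr1 determinant (erefl (N *m U)).
rewrite {1}det_mulmx mulmx_block !mulmx1 !mul1mx add0r.
rewrite mulNmx mulmxN opprK mul_mx_scalar mulmxN mul_scalar_mx subrr.
rewrite mulmx0 add0r det_ublock det_lblock det1 mulr1 det_scalar expr1 detN => e.
by rewrite mulrC e det_scalar det_mx11 !mxE eqxx mulr1n.
Qed.

Lemma char_poly_tr (F : comNzRingType) (m : nat) (A : 'M[F]_m) :
  char_poly A^T = char_poly A.
Proof.
rewrite /char_poly -[RHS]det_tr; congr determinant.
by rewrite /char_poly_mx linearB /= tr_scalar_mx map_trmx.
Qed.

(* Deflation replaces one copy of the eigenvalue 1 by 0: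
   (X - 1)(X - B) = (X - A)((X - 1) + x y). *)
Lemma char_poly_deflation (F : fieldType) (m : nat) (A : 'M[F]_m)
    (x : 'cV[F]_m) (y : 'rV[F]_m) : A *m x = x -> (y *m x) 0 0 = 1 ->
  'X * char_poly A = ('X - 1) * char_poly (A - x *m y).
Proof.
move=> Ax yx; set a : {poly F} := 'X - 1.
have a0 : a != 0 by rewrite -size_poly_eq0 size_XsubC.
pose px := map_mx polyC x; pose py := map_mx polyC y.
have e : a%:M *m char_poly_mx (A - x *m y)
         = char_poly_mx A *m (a%:M + px *m py).
  have Px : char_poly_mx A *m px = a *: px.
    rewrite /char_poly_mx mulmxBl -map_mxM Ax -/px mul_scalar_mx.
    by rewrite scalerBl scale1r.
  rewrite [RHS]mulmxDr mulmxA Px mul_scalar_mx mul_mx_scalar -scalemxAl -scalerDr.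
  by rewrite /char_poly_mx map_mxB map_mxM opprB addrA addrAC.
have := congr1 determinant e; rewrite !det_mulmx det_scalar => {}e.
(* Since [y x = 1], the rank-one factor contributes [a + 1 = 'X]. *)
apply: (mulfI (expf_neq0 m a0)).
rewrite [RHS]mulrCA [X in a * X]e [RHS]mulrCA (det_scalar_rank1 a px py).
rewrite -map_mxM mxE yx subrK.
by rewrite mulrA mulrC [_ ^+ _ * 'X]mulrC.
Qed.

(** * Weighted norms and the spectral theorem *)

Section Spectral.
Variables (C : numClosedFieldType) (m : nat).
Implicit Types (T B : 'M[C]_m) (f mu : 'cV[C]_m) (r : C).

Definition wnorm mu f : C := \sum_i mu i 0 * `|f i 0| ^+ 2.

Lemma wnorm1E f : wnorm (const_mx 1) f = (f^t* *m f) 0 0.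
Proof.
by rewrite mxE; apply: eq_bigr => i _; rewrite !mxE mul1r normCK mulrC.
Qed.

Lemma unitary_wnorm T f : T \is unitarymx ->
  wnorm (const_mx 1) (T *m f) = wnorm (const_mx 1) f.
Proof.
move=> /unitarymxP /mulmx1C TT; rewrite !wnorm1E trmx_mul map_mxM.
by rewrite mulmxA -[_ *m _ *m T]mulmxA TT mulmx1.
Qed.

(** In a unitary eigenbasis [T] multiplies each coordinate by an eigenvalue, and unitary maps
    preserve the norm. *)
Lemma normal_wnorm_le T r f : T \is normalmx ->
    (forall q, eigenvalue T q -> `|q| <= r) ->
  wnorm (const_mx 1) (T *m f) <= r ^+ 2 * wnorm (const_mx 1) f.
Proof.
move=> /orthomx_spectralP Teq Tr.
set U := spectralmx T in Teq; set d := spectral_diag T in Teq.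
have Uu : U \is unitarymx := spectral_unitarymx T.
have UT : U *m T = diag_mx d *m U.
  by rewrite {1}Teq !mulmxA mulmxV ?mul1mx // unitarymx_unit.
rewrite -(unitary_wnorm (T *m f) Uu) -(unitary_wnorm f Uu) mulmxA UT.
rewrite -mulmxA mul_diag_mx /wnorm mulr_sumr; apply: ler_sum => i _.
rewrite !mxE !mul1r normrM exprMn ler_wpM2r ?exprn_ge0 //.
have dr : `|d 0 i| <= r.
  apply: Tr; apply/eigenvalueP; exists (row i U).
    by rewrite -row_mul UT; apply/rowP => j; rewrite mul_diag_mx !mxE.
  (* A zero row of [U] would put a basis vector in the kernel of an invertible matrix. *)
  apply: contraL (unitarymx_unit Uu) => /eqP Ui.
  rewrite -row_free_unit -kermx_eq0; apply/negP => /eqP K.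
  have : (delta_mx 0 i : 'rV[C]_m) == 0.
    by rewrite -submx0 -K; apply/sub_kermxP; rewrite -rowE.
  by move/eqP/rowP/(_ i)/eqP; rewrite !mxE !eqxx oner_eq0.
by rewrite lerXn2r // nnegrE ?normr_ge0 // (le_trans (normr_ge0 _) dr).
Qed.

(* B is conjugate, by the diagonal of the sqrt mu_i, to a Hermitian matrix. *)
Lemma selfadjoint_wnorm_le mu B r f : (forall i, 0 < mu i 0) ->
    (forall i j, mu i 0 * B i j = mu j 0 * (B j i)^*) ->
    (forall q, eigenvalue B q -> `|q| <= r) ->
  wnorm mu (B *m f) <= r ^+ 2 * wnorm mu f.
Proof.
move=> mu0 Bsym Br; pose s i := sqrtC (mu i 0).
have s0 i : 0 < s i by rewrite sqrtC_gt0.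
have sN i : s i != 0 by rewrite gt_eqF.
have sE i : mu i 0 = s i ^+ 2 by rewrite sqrtCK.
have sJ i : (s i)^* = s i by apply: CrealP; rewrite gtr0_real.
pose T : 'M[C]_m := \matrix_(i, j) (s i * B i j / s j).
have Th : T^t* = T.
  apply/matrixP => i j; rewrite !mxE !rmorphM fmorphV /= !sJ.
  apply: (mulfI (mulf_neq0 (sN i) (sN j))).
  have si := sN i; have sj := sN j; transitivity (mu j 0 * (B j i)^*).
    by rewrite sE; field.
  by rewrite -Bsym sE; field.
have wE g : wnorm mu g = wnorm (const_mx 1) (\col_i (s i * g i 0)).
  apply: eq_bigr => i _.
  by rewrite !mxE mul1r normrM exprMn (gtr0_norm (s0 i)) -sE.
have TE : \col_i (s i * (B *m f) i 0) = T *m \col_i (s i * f i 0).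
  apply/colP => i; rewrite !mxE mulr_sumr; apply: eq_bigr => j _.
  by rewrite !mxE mulrA -(mulrA (s i * _)) mulKf.
rewrite !wE TE; apply: normal_wnorm_le.
  by apply/normalmxP; rewrite Th.
move=> q /eigenvalueP [v vT vN]; apply: Br; apply/eigenvalueP.
(* [eigenvalue] refers to row vectors: with [S] the diagonal matrix of [s] and [T = S B S^-1],
   [v T = q v] gives [(v S) B = q (v S)]. *)
exists (\row_i (v 0 i * s i)).
  apply/rowP => j; have /rowP/(_ j) := vT.
  rewrite !mxE => e; rewrite [RHS]mulrA -e mulr_suml; apply: eq_bigr => i _.
  by rewrite !mxE -!mulrA mulVf // mulr1.
apply: contra vN => /eqP /rowP v0; apply/eqP/rowP => i.
have := v0 i; rewrite !mxE => /eqP.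
by rewrite mulf_eq0 (negbTE (sN i)) orbF => /eqP.
Qed.

Lemma wnorm_ge0 mu f : (forall i, 0 <= mu i 0) -> 0 <= wnorm mu f.
Proof. by move=> mu0; apply: sumr_ge0 => i _; rewrite mulr_ge0 ?exprn_ge0. Qed.

Lemma wnorm_eq0 mu f : (forall i, 0 < mu i 0) -> wnorm mu f = 0 -> f = 0.
Proof.
move=> mu0 /eqP; rewrite psumr_eq0 => [/allP f0|i _]; last first.
  by rewrite mulr_ge0 ?exprn_ge0 // ltW.
apply/colP => i; have := f0 i (mem_index_enum i).
by rewrite mulf_eq0 (gt_eqF (mu0 i)) expf_eq0 normr_eq0 mxE => /eqP.
Qed.

Lemma wnormZ mu a f : wnorm mu (a *: f) = `|a| ^+ 2 * wnorm mu f.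
Proof.
rewrite /wnorm mulr_sumr; apply: eq_bigr => i _.
by rewrite mxE normrM exprMn mulrCA.
Qed.

(** Pythagoras: [f - c] is orthogonal to the constants, so the cross terms vanish. The weights are
    left unnormalised to cover both [mu] and [mu u]. *)
Lemma wnorm_mean_le mu f (c d : C) : (forall i, 0 <= mu i 0) ->
    (mu^T *m (f - const_mx c)) 0 0 = 0 ->
  wnorm mu (f - const_mx c) <= wnorm mu (f - const_mx d).
Proof.
move=> mu0; rewrite mxE => h; set g := f - const_mx c in h *.
have -> : f - const_mx d = g + const_mx (c - d).
  by apply/colP => i; rewrite !mxE addrA subrK.
set e := c - d.
have -> : wnorm mu (g + const_mx e)
    = wnorm mu g + wnorm mu (const_mx e)
      + e^* * \sum_j mu^T 0 j * g j 0 + e * (\sum_j mu^T 0 j * g j 0)^*.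
  rewrite /wnorm rmorph_sum !mulr_sumr -!big_split /=; apply: eq_bigr => i _.
  rewrite !mxE !normCK rmorphD !rmorphM /= (CrealP (ger0_real (mu0 i))).
  by ring.
by rewrite h conjC0 !mulr0 !addr0 lerDl wnorm_ge0.
Qed.

(** * Variance as a squared norm modulo constants *)

Definition disp mu f : C := wnorm mu (f - const_mx ((mu^T *m f) 0 0)).

Lemma disp_add_const mu f c : \sum_i mu i 0 = 1 ->
  disp mu (f + const_mx c) = disp mu f.
Proof.
move=> mu1; congr (wnorm mu _); apply/colP => i.
have -> : (mu^T *m (f + const_mx c)) 0 0 = (mu^T *m f) 0 0 + c.
  rewrite mulmxDr mxE; congr (_ + _); rewrite mxE -[RHS]mul1r -mu1 mulr_suml.
  by apply: eq_bigr => j _; rewrite !mxE.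
set a := (mu^T *m _) 0 0; rewrite !mxE; ring.
Qed.

Lemma dispZ mu a f : disp mu (a *: f) = `|a| ^+ 2 * disp mu f.
Proof.
rewrite -wnormZ scalerBr; congr (wnorm mu (_ - _)); apply/colP => i.
by rewrite -scalemxAr !mxE.
Qed.

Lemma disp_le mu f c : (forall i, 0 <= mu i 0) -> \sum_i mu i 0 = 1 ->
  disp mu f <= wnorm mu (f - const_mx c).
Proof.
move=> mu0 mu1; apply: wnorm_mean_le => //.
set a := (mu^T *m f) 0 0; rewrite mulmxBr.
suff -> : mu^T *m const_mx a = mu^T *m f by rewrite subrr mxE.
apply/matrixP => i j; rewrite !ord1 -/a mxE -[RHS]mul1r -mu1 mulr_suml.
by apply: eq_bigr => k _; rewrite !mxE.
Qed.

(** * Contraction by a tilted matrix *)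

(** The constant is assembled from [lo^-2] (division by [P u >= lo]), [r^2] (the deflation [B]), one
    [hi] from [u^2 <= hi u] and one from [mu u <= hi mu]. *)
Lemma tilted_disp_le mu (u v : 'cV[C]_m) (P T : 'M[C]_m) (r lo hi : C) :
    (forall i, 0 < mu i 0) -> \sum_i mu i 0 = 1 ->
    (forall i j, 0 <= P i j) -> (forall i, \sum_j P i j = 1) ->
    (forall i j, mu i 0 * P i j = mu j 0 * P j i) ->
    0 < lo -> (forall i, lo <= u i 0) -> (forall i, u i 0 <= hi) ->
    (forall q, eigenvalue (P - const_mx 1 *m mu^T) q -> `|q| <= r) ->
    (forall i k, T i k = P i k * u k 0 / (P *m u) i 0) ->
  disp mu (T *m v) <= (r * (hi / lo)) ^+ 2 * disp mu v.
Proof.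
move=> mu0 mu1 P0 P1 Psym lo0 ulo uhi Pr TE; set B := P - _ in Pr.
have mu0' i : 0 <= mu i 0 := ltW (mu0 i).
have u0 i : 0 < u i 0 := lt_le_trans lo0 (ulo i).
have lePu i : lo <= (P *m u) i 0.
  rewrite mxE -[lo]mul1r -(P1 i) mulr_suml; apply: ler_sum => j _.
  by rewrite ler_wpM2l.
have Pu0 i : 0 < (P *m u) i 0 := lt_le_trans lo0 (lePu i).
pose w : 'cV[C]_m := \col_i (mu i 0 * u i 0).
have w0 i : 0 < w i 0 by rewrite mxE mulr_gt0.
pose Z := \sum_i w i 0.
(* An index is needed for [Z] to be nonzero; without one every norm is an empty sum. *)
have [m0|/card_gt0P [i0 _]] := posnP #|'I_m|.
  have e (g : 'cV[C]_m) : wnorm mu g = 0.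
    by rewrite /wnorm big1 // => i _; have := card0_eq m0 i; rewrite inE.
  by rewrite /disp !e mulr0.
have Z0 : Z != 0.
  rewrite gt_eqF // /Z (bigD1 i0) //= ltr_pwDl //.
  by apply: sumr_ge0 => i _; exact: ltW.
(* The mean of [v] for the weights [mu u]: then [u (v - c)] has [mu]-mean zero, and [P] agrees with
   its deflation there. *)
pose c := (\sum_i w i 0 * v i 0) / Z.
have wc : (w^T *m (v - const_mx c)) 0 0 = 0.
  transitivity (\sum_i w i 0 * v i 0 - Z * c); last first.
    by rewrite /c mulrC divfK // subrr.
  rewrite mxE /Z mulr_suml -sumrB; apply: eq_bigr => i _.
  by rewrite !mxE mulrBr.
pose f : 'cV[C]_m := \col_i (u i 0 * (v i 0 - c)).
have Bf : B *m f = P *m f.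
  rewrite mulmxBl -mulmxA.
  suff -> : mu^T *m f = 0 by rewrite mulmx0 subr0.
  apply/matrixP => i j; rewrite !ord1 [RHS]mxE -wc !mxE.
  by apply: eq_bigr => k _; rewrite !mxE; ring.
have Tv : T *m v - const_mx c = \col_i ((B *m f) i 0 / (P *m u) i 0).
  apply/colP => i; rewrite Bf !mxE.
  have Pui := lt0r_neq0 (Pu0 i); rewrite mxE in Pui.
  apply: (mulIf Pui); rewrite divfK // mulrBl !mulr_suml mulr_sumr -sumrB.
  apply: eq_bigr => k _; rewrite TE !mxE.
  by field.
have Bsym i j : mu i 0 * B i j = mu j 0 * (B j i)^*.
  rewrite !mxE !big_ord1 !mxE !mul1r.
  rewrite rmorphB /= !(CrealP (ger0_real _)) //.
  by rewrite !mulrBr Psym (mulrC (mu i 0)).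
have hi0 : 0 < hi := lt_le_trans (u0 i0) (uhi i0).
have step1 : wnorm mu (T *m v - const_mx c) <= lo ^- 2 * wnorm mu (B *m f).
  rewrite Tv /wnorm mulr_sumr; apply: ler_sum => i _.
  rewrite [X in _ * `|X| ^+ 2 <= _]mxE normrM exprMn [leRHS]mulrCA.
  rewrite ler_wpM2l // mulrC ler_wpM2r ?exprn_ge0 //.
  rewrite -exprVn gtr0_norm ?invr_gt0 //; apply: lerXn2r.
  - by rewrite nnegrE invr_ge0 ltW.
  - by rewrite nnegrE invr_ge0 ltW.
  - by rewrite lef_pV2 ?posrE.
have step2 : wnorm mu f <= hi * wnorm w (v - const_mx c).
  rewrite /wnorm mulr_sumr; apply: ler_sum => i _.
  rewrite !mxE normrM exprMn (gtr0_norm (u0 i)).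
  have -> : hi * (mu i 0 * u i 0 * `|v i 0 - c| ^+ 2)
    = mu i 0 * ((hi * u i 0) * `|v i 0 - c| ^+ 2) by ring.
  by rewrite ler_wpM2l // ler_wpM2r ?exprn_ge0 // expr2 ler_wpM2r // ltW.
(* As [c] is optimal for [w], the [mu]-mean of [v] may replace it before [w] is bounded by
   [hi mu]. *)
have step3 : wnorm w (v - const_mx c) <= hi * disp mu v.
  apply: le_trans (wnorm_mean_le ((mu^T *m v) 0 0) (fun i => ltW (w0 i)) wc) _.
  rewrite /disp /wnorm mulr_sumr; apply: ler_sum => i _.
  by rewrite [w i 0]mxE mulrA ler_wpM2r ?exprn_ge0 // mulrC ler_wpM2r.
apply: le_trans (disp_le _ c mu0' mu1) _.
apply: le_trans step1 _.
have -> : (r * (hi / lo)) ^+ 2 * disp mu v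
  = lo ^- 2 * (r ^+ 2 * (hi * (hi * disp mu v))).
  by have loN := lt0r_neq0 lo0; field.
rewrite ler_wpM2l ?invr_ge0 ?exprn_ge0 ?(ltW lo0) //.
apply: le_trans (selfadjoint_wnorm_le _ mu0 Bsym Pr) _.
(* The sign of [r] comes from an eigenvalue of [B], which exists as [m > 0]. *)
have r2 : 0 <= r ^+ 2.
  have [q /Pr qr] := eigenvalue_closed B (leq_ltn_trans (leq0n i0) (ltn_ord i0)).
  by rewrite exprn_ge0 // (le_trans (normr_ge0 _) qr).
rewrite ler_wpM2l //; apply: le_trans step2 _.
by rewrite ler_wpM2l // ltW.
Qed.

(** * Eigenvalue bounds for deflations *)

(** For a column eigenvector [v] of the deflation, [A v] is [q v] plus a constant, so its variance
    is [|q|^2] times that of [v]. If [q] is nonzero the latter is positive, because the deflation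
    kills constants. *)
Lemma eigenvalue_disp_le mu (A : 'M[C]_m) (k q : C) :
    (forall i, 0 < mu i 0) -> \sum_i mu i 0 = 1 ->
    A *m const_mx 1 = const_mx 1 :> 'cV_m -> 0 <= k ->
    (forall v, disp mu (A *m v) <= k ^+ 2 * disp mu v) ->
    eigenvalue (A - const_mx 1 *m mu^T) q -> `|q| <= k.
Proof.
move=> mu0 mu1 A1 k0 Ak; set B := A - _.
have [-> _|q0] := eqVneq q 0; first by rewrite normr0.
(* Transposing trades row eigenvectors for column ones. *)
rewrite eigenvalue_root_char -char_poly_tr -eigenvalue_root_char.
case/eigenvalueP => x /(congr1 trmx); rewrite trmx_mul trmxK linearZ /=.
set v := x^T => Bv x0.
set a := (mu^T *m v) 0 0.
have Av : A *m v = q *: v + const_mx a.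
  rewrite -Bv mulmxBl -mulmxA [mu^T *m v]mx11_scalar mul_mx_scalar -/a.
  by apply/colP => i; rewrite !mxE mulr1 subrK.
have v0 : 0 < disp mu v.
  rewrite lt_def wnorm_ge0 ?andbT => [|i]; last exact: ltW.
  apply: contra x0 => /eqP /(wnorm_eq0 mu0) /subr0_eq ve.
  have : q *: v = 0.
    rewrite -Bv ve mulmxBl -mulmxA.
    have -> : const_mx a = a *: const_mx 1 :> 'cV[C]_m.
      by apply/colP => i; rewrite !mxE mulr1.
    rewrite -!scalemxAr A1.
    suff -> : mu^T *m (const_mx 1 : 'cV_m) = 1%:M by rewrite mulmx1 subrr.
    apply/matrixP => i j; rewrite !ord1 mxE [RHS]mxE eqxx mulr1n -[RHS]mu1.
    by apply: eq_bigr => l _; rewrite !mxE mulr1.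
  move/eqP; rewrite scaler_eq0 (negbTE q0) => /eqP v00.
  by rewrite -[x]trmxK -/v v00 trmx0.
have := Ak v; rewrite Av disp_add_const // dispZ ler_pM2r //.
by rewrite ler_pXn2r ?nnegrE.
Qed.

(* For q <> 0 a row eigenvector of the deflation kills constants, hence is one
   of A itself; there the l1 norm does not increase. *)
Lemma stochastic_deflation_le1 mu (A : 'M[C]_m) (q : C) :
    (forall i j, 0 <= A i j) -> (forall i, \sum_j A i j = 1) ->
    \sum_i mu i 0 = 1 ->
  eigenvalue (A - const_mx 1 *m mu^T) q -> `|q| <= 1.
Proof.
move=> A0 A1 mu1 /eigenvalueP [v vB vN].
have [->|q0] := eqVneq q 0; first by rewrite normr0.
have v1 : v *m (const_mx 1 : 'cV_m) = 0.
  apply: (scalerI q0); rewrite scaler0 scalemxAl -vB -mulmxA.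
  suff -> : (A - const_mx 1 *m mu^T) *m (const_mx 1 : 'cV_m) = 0.
    by rewrite mulmx0.
  apply/colP => i; rewrite mulmxBl -mulmxA !mxE big_ord1 !mxE mul1r.
  under eq_bigr do rewrite !mxE mulr1.
  under [X in _ - X]eq_bigr do rewrite !mxE mulr1.
  by rewrite A1 mu1 subrr.
have vA : v *m A = q *: v by rewrite -vB mulmxBr mulmxA v1 mul0mx subr0.
pose N := \sum_i `|v 0 i|.
have N0 : 0 < N.
  rewrite lt_def sumr_ge0 ?andbT // psumr_eq0 //.
  apply: contra vN => /allP h; apply/eqP/rowP => i.
  by have := h i (mem_index_enum i); rewrite normr_eq0 mxE => /eqP.
have : `|q| * N <= N.
  rewrite /N mulr_sumr; apply: (@le_trans _ _ (\sum_j \sum_i `|v 0 i| * A i j)).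
    apply: ler_sum => j _; have /rowP/(_ j) := vA; rewrite !mxE -normrM => <-.
    apply: le_trans (ler_norm_sum _ _ _) _; apply: ler_sum => i _.
    by rewrite normrM (ger0_norm (A0 i j)).
  rewrite exchange_big /=; apply: ler_sum => i _.
  by rewrite -mulr_sumr A1 mulr1.
by rewrite -[leRHS]mul1r ler_pM2r.
Qed.

End Spectral.

(** * Ordered eigenvalue lists of real matrices *)

Section RealMatrices.
Variable R : realType.
Local Open Scope complex_scope.
Local Notation toC := (real_complex R).

Lemma cmodE (z : R[i]) : (cmod z)%:C = `|z|.
Proof. by rewrite RRe_real // normr_real. Qed.

Lemma ler_cmod (z w : R[i]) : (cmod z <= cmod w) = (`|z| <= `|w|).
Proof. by rewrite -!cmodE lecR. Qed.

Lemma cmod_ge0 (z : R[i]) : 0 <= cmod z.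
Proof. by rewrite -ler0c cmodE. Qed.

(** The added entries 0 and 1 are the roots of the factors ['X] and ['X - 1] in the deflation
    identity. *)
Lemma eigenvalue_deflation (m : nat) (A : 'M[R]_m) (mu : 'cV[R]_m) :
    A *m const_mx 1 = const_mx 1 :> 'cV_m -> \sum_i mu i 0 = 1 ->
  perm_eq (0 :: eigenvalues A)
          (1 :: eigenvalues (A - const_mx 1 *m mu^T)).
Proof.
move=> A1 mu1; apply: prod_XsubC_eq; rewrite !big_cons subr0.
rewrite -!char_polyC_eigenvalues /char_polyC map_mxB map_mxM.
apply: char_poly_deflation; first by rewrite -map_mxM A1.
rewrite -map_mxM mxE -[RHS](rmorph1 toC) -[in RHS]mu1 mxE; congr (toC _).
by apply: eq_bigr => i _; rewrite !mxE mulr1.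
Qed.

Lemma mem_eigenvalues (m : nat) (A : 'M[R]_m) (q : R[i]) :
  (q \in eigenvalues A) = eigenvalue (map_mx toC A) q.
Proof.
by rewrite eigenvalue_root_char -/(char_polyC A) char_polyC_eigenvalues
           root_prod_XsubC.
Qed.

(** Here [s] stands for the spectrum of a deflation. If the leading eigenvalue of [A] is not 1, it
    survives in [s]; otherwise the second one does. *)
Lemma lambda2_le (m : nat) (A : 'M[R]_m) (s : seq R[i]) :
    (2 <= m)%N -> perm_eq (0 :: eigenvalues A) (1 :: s) ->
  exists2 q, q \in s & cmod (lambda 2 A) <= cmod q.
Proof.
rewrite -{1}(size_eigenvalues A) /lambda /=; have := eigenvalues_sorted A.
case: (eigenvalues A) => [|a [|b t]] //= /andP[ba _] _ p.
have [a1|aN] := eqVneq a 1; last first.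
  exists a => //; have := perm_mem p a.
  by rewrite !inE (negbTE aN) eqxx orbT => /esym.
exists b => //; move: p; rewrite {}a1 perm_sym => p.
have : perm_eq (1 :: s) (1 :: 0 :: b :: t).
  by apply: perm_trans p _; rewrite (perm_catCA [:: 0] [:: 1]).
by rewrite perm_cons => /perm_mem ->; rewrite !inE eqxx orbT.
Qed.

(** A nonzero [q] either occurs beyond the first place in the list of [A], or heads it with 1
    occurring further on. *)
Lemma lambda2_ge (m : nat) (A : 'M[R]_m) (s : seq R[i]) (q : R[i]) :
    perm_eq (0 :: eigenvalues A) (1 :: s) -> q \in s -> cmod q <= 1 ->
  cmod q <= cmod (lambda 2 A).
Proof.
move=> p qs q1; have [->|q0] := eqVneq q 0.
  by rewrite ler_cmod normr0.
have one1 : cmod (1 : R[i]) = 1 by apply: complexI; rewrite cmodE normr1.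
rewrite -one1 in q1.
(* For [q = 1] the copy in [s] adds to the one in front, so 1 is at least a double eigenvalue of
   [A]. *)
have cnt : (1 + (q == 1%R) <= count_mem q (0%R :: eigenvalues A))%N.
  rewrite (permP p) /= (eq_sym 1) addnC leq_add2l.
  by rewrite -has_count has_pred1.
have m1 : 1 \in eigenvalues A.
  by have := perm_mem p 1; rewrite !inE eqxx /= (negbTE (oner_neq0 _)).
move: cnt m1; rewrite /= (eq_sym 0) (negbTE q0) add0n /lambda /=.
have := eigenvalues_sorted A.
case: (eigenvalues A) => [|a t] //=.
rewrite (path_sortedE (fun x y z h1 h2 => le_trans h2 h1)).
case/andP=> _; case: t => [|b t] /=.
  (* A one-element list would be [[:: 1]], against the count. *)
  rewrite addn0 inE => _; case: (eqVneq a q) => [->|] //=.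
  by case: eqVneq => // _; rewrite ltnn.
rewrite (path_sortedE (fun x y z h1 h2 => le_trans h2 h1)) => /andP[/allP bt _].
have bbt z : z \in b :: t -> cmod z <= cmod b.
  by rewrite inE => /orP[/eqP -> //|/bt].
case: (eqVneq a q) => [->|aq] cnt m1; last first.
  apply: bbt; rewrite -has_pred1 has_count.
  by move: cnt; rewrite add0n; apply: leq_trans; rewrite addSn.
have [q1e|qN1] := eqVneq q 1.
  apply: bbt; rewrite -has_pred1 has_count.
  by move: cnt; rewrite q1e eqxx.
apply: le_trans q1 _; apply: bbt.
by move: m1; rewrite inE eq_sym (negbTE qN1).
Qed.

(** * Tilted matrices and detailed balance *)

Lemma Dinv_diag (m : nat) (x : 'cV[R]_m) : (forall i, x i 0 != 0) ->
  Dinv x = diag_mx (\row_i (x i 0)^-1).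
Proof.
move=> x0; set E := diag_mx _.
have DE : D x *m E = 1%:M.
  rewrite mulmx_diag -diag_const_mx; congr diag_mx.
  by apply/rowP => i; rewrite !mxE mulfV.
by have [xu _] := mulmx1_unit DE; rewrite /Dinv -[E](mulKmx xu) DE mulmx1.
Qed.

Lemma stochastic_const (m : nat) (P : 'M[R]_m) : stochastic P ->
  P *m const_mx 1 = const_mx 1 :> 'cV_m.
Proof.
case=> _ P1; apply/colP => i; rewrite !mxE -[RHS](P1 i).
by apply: eq_bigr => j _; rewrite mxE mulr1.
Qed.

(** Entries of [P u] are averages of entries of [u], hence at least [vmin u]. *)
Lemma stochastic_pos (m : nat) (P : 'M[R]_m) (u : 'cV[R]_m) :
  stochastic P -> positive u -> positive (P *m u).
Proof.
case=> P0 P1 u0 i; have m0 := leq_ltn_trans (leq0n i) (ltn_ord i).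
have [j uj] := vmin_entries u m0.
apply: lt_le_trans (_ : vmin u <= _); first by rewrite uj.
rewrite mxE -[vmin u]mul1r -(P1 i) mulr_suml; apply: ler_sum => k _.
by rewrite ler_wpM2l // vmin_lb.
Qed.

Lemma tiltedE (m : nat) (P : 'M[R]_m) (u : 'cV[R]_m) i j :
    stochastic P -> positive u ->
  tilted P u i j = P i j * u j 0 / (P *m u) i 0.
Proof.
move=> sP u0; rewrite /tilted Dinv_diag => [|k]; last first.
  exact: lt0r_neq0 (stochastic_pos sP u0 k).
rewrite -mulmxA mul_diag_mx mxE [X in X * _]mxE /D mul_mx_diag mxE mulrC.
by rewrite [_^T _ _]mxE.
Qed.

Lemma tilted_const (m : nat) (P : 'M[R]_m) (u : 'cV[R]_m) :
    stochastic P -> positive u ->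
  tilted P u *m const_mx 1 = const_mx 1 :> 'cV_m.
Proof.
move=> sP u0; apply/colP => i; rewrite mxE [RHS]mxE.
under eq_bigr do rewrite tiltedE // [const_mx _ _ _]mxE mulr1.
rewrite -mulr_suml; have := stochastic_pos sP u0 i; rewrite mxE => Pu.
by rewrite mulfV // lt0r_neq0.
Qed.

(** Detailed balance: the form of reversibility that makes [P], and then its deflation, self-adjoint
    for [mu]. *)
Lemma reversible_balance (m : nat) (P : 'M[R]_m) (mu : 'cV[R]_m) i j :
    positive mu -> P = Dinv mu *m P^T *m D mu ->
  mu i 0 * P i j = mu j 0 * P j i.
Proof.
move=> mu0 Pe; have muN k : mu k 0 != 0 := lt0r_neq0 (mu0 k).
rewrite {1}Pe Dinv_diag // -mulmxA mul_diag_mx /D mul_mx_diag !mxE mulrA.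
by rewrite mulfV // mul1r mulrC.
Qed.

(** * Composing the contractions *)

(** Deflation is used twice: [lambda2_ge] bounds the deflated spectrum of [P], which drives each
    contraction, and [lambda2_le] reads off [lambda 2] of the product. *)
Lemma lambda2_tilted_prod_le (m n : nat) (hm : (2 <= m)%N)
  (u : 'I_n -> 'cV[R]_m) (hu : forall i, positive (u i))
  (P : 'M[R]_m) (hP : stochastic P) (hrev : reversible P) :
  cmod (lambda 2 (\prod_(i < n) tilted P (u i)))
    <= \prod_(i < n) (cmod (lambda 2 P) * (vmax (u i) / vmin (u i))).
Proof.
have m0 : (0 < m)%N := ltnW hm.
have [mu [[_ mu1 _] mu0 Pe]] := hrev; have [P0 P1] := hP.
pose l := cmod (lambda 2 P); set M := \prod_(i < n) _.
set K := \prod_(i < n) (l * _).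
pose muC := map_mx toC mu.
have muC0 i : 0 < muC i 0 by rewrite mxE ltcR.
have muC1 : \sum_i muC i 0 = 1.
  rewrite -(rmorph1 toC) -mu1 rmorph_sum.
  by apply: eq_bigr => i _; rewrite mxE.
have defC (A : 'M[R]_m) :
    map_mx toC (A - const_mx 1 *m mu^T) = map_mx toC A - const_mx 1 *m muC^T.
  by rewrite map_mxB map_mxM map_const_mx map_trmx rmorph1.
have lo0 i : 0 < vmin (u i) by have [j ->] := vmin_entries (u i) m0; exact: hu.
have hi0 i : 0 < vmax (u i) by have [j ->] := vmax_entries (u i) m0; exact: hu.
have Pl q : eigenvalue (map_mx toC P - const_mx 1 *m muC^T) q -> `|q| <= l%:C.
  move=> qB; rewrite cmodE -ler_cmod.
  apply: lambda2_ge (eigenvalue_deflation (stochastic_const hP) mu1) _ _.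
    by rewrite mem_eigenvalues defC.
  rewrite -lecR cmodE; apply: stochastic_deflation_le1 qB => // [i j|i].
    by rewrite mxE ler0c.
  rewrite -(rmorph1 toC) -(P1 i) rmorph_sum.
  by apply: eq_bigr => j _; rewrite mxE.
have Pu_le i v : disp muC (map_mx toC (tilted P (u i)) *m v)
    <= (l * (vmax (u i) / vmin (u i)))%:C ^+ 2 * disp muC v.
  have -> : (l * (vmax (u i) / vmin (u i)))%:C
      = l%:C * ((vmax (u i))%:C / (vmin (u i))%:C).
    by rewrite rmorphM /= fmorph_div.
  apply: (@tilted_disp_le _ _ _ (map_mx toC (u i)) _ (map_mx toC P)) => //.
  - by move=> j k; rewrite mxE ler0c.
  - move=> j; rewrite -(rmorph1 toC) -(P1 j) rmorph_sum.
    by apply: eq_bigr => k _; rewrite mxE.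
  - move=> j k; rewrite !mxE -!rmorphM; congr (toC _).
    exact: reversible_balance.
  - by rewrite ltcR.
  - by move=> j; rewrite mxE lecR vmin_lb.
  - by move=> j; rewrite mxE lecR vmax_ub.
  - move=> j k; rewrite -map_mxM [LHS]mxE tiltedE // [in RHS]mxE.
    rewrite [map_mx _ (u i) _ _]mxE [map_mx _ (P *m _) _ _]mxE.
    by rewrite fmorph_div rmorphM.
have [M1 K0 MK] : [/\ M *m const_mx 1 = const_mx 1 :> 'cV_m, 0 <= K &
    forall v, disp muC (map_mx toC M *m v) <= K%:C ^+ 2 * disp muC v].
  (* The induction also carries the fixed constants, needed to deflate the product, and [0 <= k],
     needed to take square roots at the end. *)
  apply: (big_rec2 (fun (A : 'M_m) k => [/\
    A *m const_mx 1 = const_mx 1 :> 'cV_m, 0 <= k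
    & forall v, disp muC (map_mx toC A *m v) <= k%:C ^+ 2 * disp muC v])).
    split=> [||v] //; first exact: mul1mx.
    by rewrite [map_mx _ _]map_mx1 mul1mx rmorph1 expr1n mul1r.
  move=> i A k _ [A1 k0 Ak]; split=> [||v].
  - by rewrite -mulmxA A1 tilted_const.
  - by rewrite mulr_ge0 // mulr_ge0 ?cmod_ge0 // divr_ge0 ?ltW.
  - rewrite map_mxM -mulmxA; apply: le_trans (Pu_le i _) _.
    rewrite [toC (_ * k)]rmorphM exprMn -[leRHS]mulrA.
    apply: ler_wpM2l (Ak v).
    by rewrite exprn_ge0 // ler0c mulr_ge0 ?cmod_ge0 // divr_ge0 ?ltW.
have [q qM] := lambda2_le hm (eigenvalue_deflation M1 mu1).
move/le_trans; apply; rewrite -lecR cmodE.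
apply: (eigenvalue_disp_le muC0 muC1 _ _ MK).
- by rewrite -[const_mx 1](map_const_mx toC) -map_mxM M1.
- by rewrite ler0c.
- by rewrite -defC -mem_eigenvalues.
Qed.

End RealMatrices.

(** * Passage to the fourth power *)

Theorem theorem2 (R : realType) (m n : nat) (hm : (2 <= m)%N) (hn : (1 <= n)%N)
  (u : 'I_n -> 'cV[R]_m) (hu : forall i, positive (u i))
  (P : 'M[R]_m) (hP : stochastic P) (hrev : reversible P) :
  cmod (lambda 2 (\prod_(i < n) tilted P (u i)))
    <= cmod (lambda 2 P) ^+ n
       * \prod_(i < n) (vmax (u i) / vmin (u i)) ^+ 4.
Proof.
apply: le_trans (lambda2_tilted_prod_le hm hu hP hrev) _.
rewrite -[X in _ ^+ X](card_ord n) -prodr_const -big_split /=.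
pose j0 : 'I_m := Ordinal (ltnW hm); apply: ler_prod => i _.
have lo0 : 0 < vmin (u i).
  by have [j ->] := vmin_entries (u i) (ltnW hm); exact: hu.
(* A ratio that is at least 1 is at most its fourth power. *)
have r1 : 1 <= vmax (u i) / vmin (u i).
  by rewrite ler_pdivlMr // mul1r (le_trans (vmin_lb (u i) j0)) // vmax_ub.
have r0 := le_trans ler01 r1.
by rewrite mulr_ge0 ?cmod_ge0 //= ler_wpM2l ?cmod_ge0 // ler_eXnr.
Qed.
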